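(* Let $R>0$ be real, let $D\in\mathbb{R}$, and let $\omega$ be a complex-valued function given for $|k|<R$ by its Taylor series around $k=0$, which has radius of convergence $R$ and the form $$\omega(k)=-iDk^2+\ldots,$$ where the dots denote terms of order $k^3$ and higher (with arbitrary complex coefficients). Suppose that $\operatorname{Im}\omega(k)\le|\operatorname{Im} k|$ for all $k\in\mathbb{C}$ with $|k|<R$. Then $$0\le D\le\frac{16}{3\pi}\frac{1}{R}.$$ *)

(* Defs.v *)
(* World: Stdlib reals and Coquelicot. *)
From Stdlib Require Export Reals.
From Coquelicot Require Export Coquelicot.

Open Scope R_scope.

(* [is_pseries] over C, with coefficients and argument both complex; the scalar
   structure is fixed to [C_AbsRing] because C is also a normed module over R. *)
Definition is_Cpseries (a : nat -> C) (k l : C) : Prop :=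
  @is_pseries C_AbsRing C_NormedModule a k l.

(* Coquelicot's [CV_radius] only covers real coefficients. *)
Definition CCV_radius (a : nat -> C) : Rbar :=
  Lub_Rbar (fun r : R => exists k : C, Cmod k = r /\ exists l : C, is_Cpseries a k l).

(* Main.v *)
Require Import Defs.
From Stdlib Require Import Reals Lra Lia.
From Coquelicot Require Import Coquelicot.

(** Write c n = Im (a n). The average of Im omega over r e^(it) and its conjugate
    is the cosine series of terms c n r^n cos(nt), and it is at most r |sin t|.
    Integrate this inequality over [0, PI] against the nonnegative weight
    1 - cos(2t) = 2 sin^2 t: as c 0 = c 1 = 0, only c 2 = -D contributes on the
    left, giving PI D r^2 / 2 <= 8 r / 3; then let r tend to R0. The series is
    truncated with a uniform error, so only trigonometric polynomials get
    integrated. At t = 0 the inequality says that x^2 (- D + O(x)) <= 0 for small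
    x > 0, hence D >= 0. *)

Lemma is_series_Im (u : nat -> C) (l : C) :
  @is_series C_AbsRing C_NormedModule u l -> is_series (fun n => Im (u n)) (Im l).
Proof.
intros Hu.
assert (E : forall n, sum_n (fun k => Im (u k)) n
                      = Im (@sum_n (NormedModule.AbelianMonoid C_AbsRing C_NormedModule) u n)).
{ induction n as [|n IH].
  - now rewrite !sum_O.
  - rewrite !sum_Sn, IH. reflexivity. }
unfold is_series.
apply filterlim_ext with (1 := fun n => eq_sym (E n)).
apply filterlim_comp with (1 := Hu).
intros P [eps HP].
exists eps. intros y Hy. apply HP. apply Hy.
Qed.

Lemma pow_polar (r t : R) (n : nat) :
  @pow_n C_Ring (r * cos t, r * sin t) n
  = (r ^ n * cos (INR n * t), r ^ n * sin (INR n * t)).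
Proof.
induction n as [|n IH].
- simpl. rewrite Rmult_0_l, cos_0, sin_0. unfold one; simpl. unfold RtoC. f_equal; ring.
- change (@pow_n C_Ring (r * cos t, r * sin t) (S n)) with
    (Cmult (r * cos t, r * sin t) (@pow_n C_Ring (r * cos t, r * sin t) n)).
  rewrite IH, S_INR.
  replace ((INR n + 1) * t) with (INR n * t + t) by ring.
  rewrite cos_plus, sin_plus. unfold Cmult; simpl. f_equal; ring.
Qed.

Lemma Cmod_polar (r t : R) : 0 <= r -> Cmod (r * cos t, r * sin t) = r.
Proof.
intros Hr. unfold Cmod; simpl.
rewrite <- (sqrt_Rsqr r Hr) at 5.
f_equal. unfold Rsqr.
generalize (sin2_cos2 t); unfold Rsqr; intros H.
transitivity (r * r * (sin t * sin t + cos t * cos t)); [ring|rewrite H; ring].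
Qed.

Lemma is_Cpseries_Im_polar (a : nat -> C) (r t : R) (l : C) :
  is_Cpseries a (r * cos t, r * sin t) l ->
  is_series (fun n => r ^ n * (Im (a n) * cos (INR n * t) + Re (a n) * sin (INR n * t)))
    (Im l).
Proof.
intros H. apply is_series_Im in H.
apply is_series_ext with (2 := H). intros n.
rewrite pow_polar. destruct (a n) as [x y]. simpl. ring.
Qed.

Lemma is_Cpseries_Im_even (a : nat -> C) (r t : R) (l l' : C) :
  is_Cpseries a (r * cos t, r * sin t) l ->
  is_Cpseries a (r * cos (- t), r * sin (- t)) l' ->
  is_series (fun n => Im (a n) * r ^ n * cos (INR n * t)) ((Im l + Im l') / 2).
Proof.
intros H H'.
apply is_Cpseries_Im_polar in H. apply is_Cpseries_Im_polar in H'.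
generalize (is_series_scal (/ 2) _ _ (is_series_plus _ _ _ _ H H')); intros K.
replace ((Im l + Im l') / 2) with (scal (/ 2) (plus (Im l) (Im l')))
  by (unfold scal, plus; simpl; unfold mult; simpl; field).
apply is_series_ext with (2 := K). intros n.
unfold scal, plus; simpl; unfold mult; simpl.
replace (INR n * - t) with (- (INR n * t)) by ring.
rewrite cos_neg, sin_neg. field.
Qed.

Lemma is_RInt_cos_INR (m : nat) : (0 < m)%nat -> is_RInt (fun t => cos (INR m * t)) 0 PI 0.
Proof.
intros Hm. assert (Hm' : 0 < INR m) by now apply lt_0_INR.
assert (Hs : sin (INR m * PI) = 0).
{ apply sin_eq_0_1. exists (Z.of_nat m). now rewrite INR_IZR_INZ. }
replace 0 with (minus (sin (INR m * PI) / INR m) (sin (INR m * 0) / INR m)) at 2.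
2:{ rewrite Hs, Rmult_0_r, sin_0. unfold minus, plus, opp; simpl. field. lra. }
apply (is_RInt_derive (fun t => sin (INR m * t) / INR m)).
- intros x _. auto_derive; [exact I|]. field. lra.
- intros x _. apply (@ex_derive_continuous R_AbsRing R_NormedModule). auto_derive. exact I.
Qed.

Lemma is_RInt_cos_weight (n : nat) : (3 <= n)%nat ->
  is_RInt (fun t => cos (INR n * t) * (1 - cos (2 * t))) 0 PI 0.
Proof.
intros Hn.
pose proof (is_RInt_cos_INR n ltac:(lia)) as H1.
pose proof (is_RInt_cos_INR (n + 2) ltac:(lia)) as H2.
pose proof (is_RInt_cos_INR (n - 2) ltac:(lia)) as H3.
pose proof (is_RInt_minus _ _ _ _ _ _ H1
  (is_RInt_scal _ _ _ (/ 2) _ (is_RInt_plus _ _ _ _ _ _ H2 H3))) as H.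
replace 0 with (minus 0 (scal (/ 2) (plus 0 0))) at 2
  by (unfold minus, opp, scal, plus; simpl; unfold mult; simpl; ring).
apply is_RInt_ext with (2 := H). intros t _.
rewrite plus_INR, minus_INR by lia. change (INR 2) with 2.
unfold minus, opp, scal, plus; simpl; unfold mult; simpl.
rewrite Rmult_plus_distr_r, Rmult_minus_distr_r, cos_plus, cos_minus. field.
Qed.

Lemma is_RInt_cos2_weight : is_RInt (fun t => cos (2 * t) * (1 - cos (2 * t))) 0 PI (- (PI / 2)).
Proof.
set (F := fun t => sin (2 * t) / 2 - t / 2 - sin (4 * t) / 8).
replace (- (PI / 2)) with (minus (F PI) (F 0)).
2:{ unfold F, minus, plus, opp; simpl.
    replace (4 * PI) with (0 + 2 * INR 2 * PI) by (simpl; ring).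
    rewrite sin_period, sin_2PI, !Rmult_0_r, sin_0. field. }
apply (is_RInt_derive F).
- intros x _. unfold F. auto_derive; [exact I|].
  replace (4 * x) with (2 * (2 * x)) by ring.
  rewrite (cos_2a_cos (2 * x)). field.
- intros x _. apply (@ex_derive_continuous R_AbsRing R_NormedModule). auto_derive. exact I.
Qed.

Lemma is_RInt_sin_weight (r e : R) :
  is_RInt (fun t => (r * sin t + e) * (1 - cos (2 * t))) 0 PI (8 / 3 * r + e * PI).
Proof.
set (F := fun t => r * (2 / 3 * cos t ^ 3 - 2 * cos t) + e * (t - sin (2 * t) / 2)).
replace (8 / 3 * r + e * PI) with (minus (F PI) (F 0)).
2:{ unfold F, minus, plus, opp; simpl.
    rewrite sin_2PI, cos_PI, !Rmult_0_r, sin_0, cos_0. field. }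
apply (is_RInt_derive F).
- intros x _. unfold F. auto_derive; [exact I|].
  rewrite (cos_2a_cos x).
  pose proof (sin2_cos2 x) as H. unfold Rsqr in H.
  field.
- intros x _. apply (@ex_derive_continuous R_AbsRing R_NormedModule). auto_derive. exact I.
Qed.

(* Orthogonality: the weight [1 - cos (2 t)] sees only the second cosine coefficient. *)
Lemma is_RInt_cos_sum_weight (b : nat -> R) (N : nat) : b 0%nat = 0 -> b 1%nat = 0 ->
  is_RInt (fun t => sum_n (fun n => b n * cos (INR n * t)) (N + 2) * (1 - cos (2 * t)))
    0 PI (- (PI / 2) * b 2%nat).
Proof.
intros b0 b1. induction N as [|N IH].
- replace (- (PI / 2) * b 2%nat) with (scal (b 2%nat) (- (PI / 2)))
    by (unfold scal; simpl; unfold mult; simpl; ring).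
  apply is_RInt_ext with (2 := is_RInt_scal _ _ _ (b 2%nat) _ is_RInt_cos2_weight).
  intros t _. change (0 + 2)%nat with 2%nat.
  rewrite !sum_Sn, sum_O, b0, b1. change (INR 2) with 2.
  unfold scal, plus; simpl; unfold mult; simpl. ring.
- pose proof (is_RInt_plus _ _ _ _ _ _ IH
    (is_RInt_scal _ _ _ (b (S (N + 2))) _ (is_RInt_cos_weight (S (N + 2)) ltac:(lia)))) as H.
  replace (- (PI / 2) * b 2%nat) with
    (plus (- (PI / 2) * b 2%nat) (scal (b (S (N + 2))) 0))
    by (unfold scal, plus; simpl; unfold mult; simpl; ring).
  apply is_RInt_ext with (2 := H). intros t _.
  change (S N + 2)%nat with (S (N + 2)). rewrite (sum_Sn _ (N + 2)).
  unfold scal, plus; cbn -[sum_n INR]; unfold mult; cbn -[sum_n INR]. ring.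
Qed.

Lemma sum_n_cos_tail (b : nat -> R) (e : posreal) : ex_series (fun n => Rabs (b n)) ->
  exists N, forall (t l : R),
    is_series (fun n => b n * cos (INR n * t)) l ->
    sum_n (fun n => b n * cos (INR n * t)) (N + 2) <= l + e.
Proof.
intros Hb. destruct (Cauchy_ex_series _ Hb e) as [N HN].
exists N. intros t l Hl. set (u := fun n => b n * cos (INR n * t)) in *.
assert (Hu : is_lim_seq (fun m => sum_n u (m + (N + 2)) + e) (l + e)).
{ apply is_lim_seq_plus'; [|apply is_lim_seq_const].
  apply -> (is_lim_seq_incr_n (sum_n u)). exact Hl. }
apply (is_lim_seq_le (fun _ => sum_n u (N + 2)) _ (sum_n u (N + 2)) (l + e)) with (3 := Hu);
  [|apply is_lim_seq_const].
intros [|m].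
- simpl. destruct e as [e He]. simpl. lra.
- assert (H : Rabs (sum_n u (S m + (N + 2)) - sum_n u (N + 2)) <= e).
  { replace (sum_n u (S m + (N + 2)) - sum_n u (N + 2))
      with (sum_n_m u (S (N + 2)) (S m + (N + 2)))
      by exact (sum_n_m_sum_n (G := R_AbelianGroup) u (N + 2) (S m + (N + 2)) ltac:(lia)).
    apply Rle_trans with (1 := norm_sum_n_m u _ _).
    apply Rle_trans with (sum_n_m (fun n => Rabs (b n)) (S (N + 2)) (S m + (N + 2))).
    - apply sum_n_m_le. intros k. unfold u, norm; simpl. unfold abs; simpl.
      rewrite Rabs_mult. rewrite <- (Rmult_1_r (Rabs (b k))) at 2.
      apply Rmult_le_compat_l; [apply Rabs_pos|].
      apply Rabs_le. apply COS_bound.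
    - apply Rle_trans with (1 := Rle_abs _). left. apply HN; lia. }
  apply Rabs_le_between in H. simpl in H |- *. lra.
Qed.

Lemma CV_radius_ge (c : nat -> R) (R0 r : R) :
  (forall x, 0 <= x < R0 -> ex_series (fun n => c n * x ^ n)) ->
  0 <= r < R0 -> Rbar_lt r (CV_radius c).
Proof.
intros Hc Hr. set (x := (r + R0) / 2).
assert (Hx : r < x < R0) by (unfold x; lra).
apply Rbar_lt_le_trans with (Finite x); [exact (proj1 Hx)|].
apply Rbar_not_lt_le. intros H.
rewrite <- (Rabs_pos_eq x) in H by lra.
apply (CV_disk_outside _ _ H). apply ex_series_lim_0. apply Hc. lra.
Qed.

Lemma PSeries_nonpos_coeff2 (c : nat -> R) (R0 : R) :
  0 < R0 -> Rbar_lt 0 (CV_radius c) -> c 0%nat = 0 -> c 1%nat = 0 ->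
  (forall x, 0 < x < R0 -> PSeries c x <= 0) -> c 2%nat <= 0.
Proof.
intros HR Hc c0 c1 Hneg. set (d := PS_decr_n c 2).
assert (Hd : continuity_pt (PSeries d) 0).
{ apply PSeries_continuity. rewrite Rabs_R0.
  change d with (PS_decr_1 (PS_decr_1 c)).
  now rewrite !CV_radius_decr_1. }
apply Rnot_lt_le. intros H2.
assert (Hd0 : PSeries d 0 = c 2%nat) by apply PSeries_0.
apply continuity_pt_locally with (eps := mkposreal _ H2) in Hd.
destruct Hd as [eta Heta]. simpl in Heta.
pose proof (cond_pos eta) as Hp.
set (x := Rmin (eta / 2) (R0 / 2)).
assert (Hx : 0 < x <= eta / 2 /\ x <= R0 / 2).
{ repeat split; [apply Rmin_glb_lt; lra|apply Rmin_l|apply Rmin_r]. }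
assert (Hb : ball 0 eta x).
{ unfold ball; simpl. unfold AbsRing_ball, abs, minus, plus, opp; simpl.
  rewrite Ropp_0, Rplus_0_r, Rabs_pos_eq; lra. }
specialize (Heta x Hb). rewrite Hd0 in Heta. apply Rabs_def2 in Heta.
specialize (Hneg x ltac:(lra)).
rewrite (PSeries_decr_n_aux c 2) in Hneg.
2:{ intros [|[|k]] Hk; [exact c0|exact c1|lia]. }
fold d in Hneg.
assert (0 < x ^ 2 * PSeries d x); [|lra].
apply Rmult_lt_0_compat; [apply pow_lt; lra|lra].
Qed.

Lemma coeff2_bound (c : nat -> R) (r : R) :
  0 < r -> c 0%nat = 0 -> c 1%nat = 0 -> ex_series (fun n => Rabs (c n * r ^ n)) ->
  (forall t, 0 < t < PI -> exists l,
     is_series (fun n => c n * r ^ n * cos (INR n * t)) l /\ l <= r * sin t) ->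
  PI / 2 * - c 2%nat * r <= 8 / 3.
Proof.
intros Hr c0 c1 Habs Hle.
apply Rmult_le_reg_r with (1 := Hr).
apply le_epsilon. intros e He.
assert (HPI := PI_RGT_0).
assert (He' : 0 < e / PI) by now apply Rdiv_lt_0_compat.
destruct (sum_n_cos_tail _ (mkposreal _ He') Habs) as [N HN]. simpl in HN.
assert (I1 := is_RInt_cos_sum_weight (fun n => c n * r ^ n) N
  ltac:(simpl; rewrite c0; ring) ltac:(simpl; rewrite c1; ring)).
assert (I2 := is_RInt_sin_weight r (e / PI)).
replace (8 / 3 * r + e) with (8 / 3 * r + e / PI * PI) by (field; lra).
replace (PI / 2 * - c 2%nat * r * r) with (- (PI / 2) * (c 2%nat * r ^ 2)) by ring.
apply is_RInt_le with (2 := I1) (3 := I2); [lra|].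
intros t Ht. destruct (Hle t Ht) as [l [Hl1 Hl2]].
apply Rmult_le_compat_r.
- generalize (COS_bound (2 * t)). lra.
- specialize (HN t l Hl1). lra.
Qed.

Theorem theorem4 (R0 D : R) (omega : C -> C) (a : nat -> C)
  (R0_pos : 0 < R0)
  (radius : CCV_radius a = Finite R0)
  (taylor : forall k : C, Cmod k < R0 -> is_Cpseries a k (omega k))
  (a0 : a 0%nat = RtoC 0)
  (a1 : a 1%nat = RtoC 0)
  (a2 : a 2%nat = Copp (Cmult Ci (RtoC D)))
  (bound : forall k : C, Cmod k < R0 -> Im (omega k) <= Rabs (Im k)) :
  0 <= D <= 16 / (3 * PI) * (1 / R0).
Proof.
set (c := fun n => Im (a n)).
assert (c0 : c 0%nat = 0) by (unfold c; now rewrite a0).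
assert (c1 : c 1%nat = 0) by (unfold c; now rewrite a1).
assert (c2 : c 2%nat = - D) by (unfold c; rewrite a2; simpl; ring).
assert (Hser : forall r t, 0 <= r < R0 -> exists l,
  is_series (fun n => c n * r ^ n * cos (INR n * t)) l /\ l <= r * Rabs (sin t)).
{ intros r t Hr.
  assert (M : forall s, Cmod (r * cos s, r * sin s) < R0)
    by (intros s; rewrite Cmod_polar; lra).
  exists ((Im (omega (r * cos t, r * sin t)) + Im (omega (r * cos (- t), r * sin (- t)))) / 2).
  split.
  - apply is_Cpseries_Im_even; apply taylor, M.
  - generalize (bound _ (M t)) (bound _ (M (- t))). simpl.
    rewrite sin_neg, <- Ropp_mult_distr_r, Rabs_Ropp, Rabs_mult, (Rabs_pos_eq r) by lra.
    lra. }
assert (Hser0 : forall x, 0 <= x < R0 -> exists l,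
  is_series (fun n => c n * x ^ n) l /\ l <= 0).
{ intros x Hx. destruct (Hser x 0 Hx) as [l [H1 H2]].
  rewrite sin_0, Rabs_R0, Rmult_0_r in H2.
  exists l. split; [|exact H2].
  apply is_series_ext with (2 := H1). intros n. now rewrite Rmult_0_r, cos_0, Rmult_1_r. }
assert (Hrad : forall r, 0 <= r < R0 -> Rbar_lt r (CV_radius c)).
{ intros r Hr. apply (CV_radius_ge c R0); [|exact Hr].
  intros x Hx. destruct (Hser0 x Hx) as [l [H _]]. now exists l. }
assert (HPI := PI_RGT_0).
split.
- enough (c 2%nat <= 0) by lra.
  apply (PSeries_nonpos_coeff2 c R0); [exact R0_pos|apply Hrad; lra|exact c0|exact c1|].
  intros x Hx. destruct (Hser0 x ltac:(lra)) as [l [H1 H2]].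
  apply is_pseries_R, is_pseries_unique in H1. now rewrite H1.
- assert (H : forall r, 0 < r < R0 -> PI / 2 * D * r <= 8 / 3).
  { intros r Hr. replace D with (- c 2%nat) by lra.
    apply coeff2_bound; [lra|exact c0|exact c1| |].
    - apply CV_disk_inside. rewrite Rabs_pos_eq by lra. apply Hrad. lra.
    - intros t Ht. destruct (Hser r t ltac:(lra)) as [l Hl]. exists l.
      rewrite Rabs_pos_eq in Hl; [exact Hl|]. apply sin_ge_0; lra. }
  assert (HR : PI / 2 * D * R0 <= 8 / 3).
  { apply Rnot_lt_le. intros Hlt.
    assert (HA : 0 < PI / 2 * D).
    { apply Rmult_lt_reg_r with (1 := R0_pos). lra. }
    set (A := PI / 2 * D) in *.
    assert (Hq : 8 / 3 / A < R0).
    { apply Rmult_lt_reg_r with (1 := HA).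
      replace (8 / 3 / A * A) with (8 / 3) by (field; lra). lra. }
    assert (Hq0 : 0 < 8 / 3 / A) by (apply Rdiv_lt_0_compat; lra).
    specialize (H ((8 / 3 / A + R0) / 2) ltac:(lra)).
    assert (A * (8 / 3 / A) = 8 / 3) by (field; lra).
    assert (A * ((8 / 3 / A + R0) / 2) = (A * (8 / 3 / A) + A * R0) / 2) by (field; lra).
    lra. }
  apply Rmult_le_reg_r with (PI / 2 * R0).
  + apply Rmult_lt_0_compat; lra.
  + replace (16 / (3 * PI) * (1 / R0) * (PI / 2 * R0)) with (8 / 3) by (field; lra).
    lra.
Qed.
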